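(* Let $b>1$ be an integer, $A\subsetneq\{0,\dots,b-1\}$ with $A\neq\{0\}$, $N=\#A$. Let $\mathcal{A}$ be the set of admissible non-negative integers (all base-$b$ digits, without leading zeros, lie in $A$; $0$ is admissible iff $0\in A$), and $\sum'$ a sum restricted to $\mathcal{A}$. For a non-negative integer $n$ let $l(n)$ be the smallest non-negative integer $l$ with $n<b^l$. Define the measure $\mu$ on $[0,\infty)$ by $$\mu=\sum_{l\geq0}b^{-l}\sum_{n\in\mathcal{A}}\delta_{n/b^l}\ \text{ if }0\in A,\qquad \mu=\delta_0+\sum_{l\geq0}b^{-l}\sum_{n\in\mathcal{A},\,l(n)\geq l}\delta_{n/b^l}\ \text{ if }0\notin A,$$ and its moments $u_m=\int_{[0,1)}x^m\,d\mu(x)$, $m\geq0$. Let $K=\sum'_{n>0}1/n$. Then for every $l\geq1$, $$K=\sum\nolimits'_{0<n<b^{l-1}}\frac1n+\sum_{m=0}^\infty(-1)^m u_m\sum\nolimits'_{l(n)=l}\frac1{n^{m+1}}.$$ Moreover the sequence $(u_m)$ is strictly decreasing and converges to zero, so the terms of the alternating series decrease strictly to zero in absolute value.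
   Context: $\delta_x$ denotes the Dirac point mass at $x$.
   Formalization: The strict decrease of (u_m) and of the absolute values of the terms is claimed only for non-empty A; for A empty, μ=δ_0, u_0=1 and u_m=0 for m≥1, so it fails. The other claims include A empty. *)

(* Defs.v *)
From HB Require Import structures.
From mathcomp Require Import all_boot all_order all_algebra.
From mathcomp Require Import all_classical all_reals all_analysis.

Set Implicit Arguments.
Unset Strict Implicit.
Unset Printing Implicit Defensive.

Import Order.TTheory GRing.Theory Num.Theory.
Import numFieldNormedType.Exports.

Local Open Scope classical_set_scope.
Local Open Scope ring_scope.

(* [numlen b n] is l(n): for [1 < b], the least [l] with [n < b ^ l]; see
   [numlenP] and [numlen_min]. In particular [numlen b 0 = 0]. *)
Definition numlen (b n : nat) : nat := up_log b n.+1.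

Lemma numlenP (b n : nat) : (1 < b)%N -> (n < b ^ numlen b n)%N.
Proof. exact: up_logP. Qed.

Lemma numlen_min (b n l : nat) : (1 < b)%N -> (n < b ^ l)%N ->
  (numlen b n <= l)%N.
Proof. exact: up_log_min. Qed.

Definition digit_in (b : nat) (A : {set 'I_b}) (d : nat) : bool :=
  [exists a in A, nat_of_ord a == d].

(* The i-th base-b digit of n is [n %/ b ^ i %% b], and the digits of n > 0
   written without leading zeros are those with [i < numlen b n]. *)
Definition admissible (b : nat) (A : {set 'I_b}) (n : nat) : bool :=
  if n == 0%N then digit_in A 0
  else [forall i : 'I_(numlen b n), digit_in A (n %/ b ^ i %% b)%N].

Section Moments.
Variables (R : realType) (b : nat) (A : {set 'I_b}).

Local Notation M := {measure set R -> \bar R}.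

Definition scale_weight (l : nat) : {nonneg R} := ((b%:R : R) ^- l)%:nng.

Definition point_masses (P : pred nat) (l : nat) : M :=
  mseries (fun n => if P n then dirac ((n%:R : R) / b%:R ^+ l) : M
                    else mzero : M) 0.

(* A measure on the whole line, carried by [0, +oo[. *)
Definition mu : M :=
  if digit_in A 0 then
    mseries (fun l => mscale (scale_weight l)
      (point_masses (admissible A) l) : M) 0 : M
  else
    measure_add (dirac (0 : R) : M)
      (mseries (fun l => mscale (scale_weight l)
         (point_masses (fun n => admissible A n && (l <= numlen b n)%N) l) : M)
         0) : M.

Definition moment (m : nat) : R := \int[mu]_(x in `[0, 1[) (x ^+ m).

Definition kempner_sum : \bar R :=
  (\sum_(1 <= n <oo | admissible A n) ((n%:R : R)^-1)%:E)%E.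

Definition head_sum (l : nat) : R :=
  \sum_(1 <= n < b ^ l.-1 | admissible A n) n%:R^-1.

(* The bound [n < b ^ l] is implied by [numlen b n = l] when [1 < b]. *)
Definition level_sum (l m : nat) : R :=
  \sum_(0 <= n < b ^ l | admissible A n && (numlen b n == l)) (n%:R ^+ m.+1)^-1.

Definition alt_term (l m : nat) : R := (-1) ^+ m * moment m * level_sum l m.

End Moments.

(* Main.v *)
Require Import Defs.
From HB Require Import structures.
From mathcomp Require Import all_boot all_order all_algebra.
From mathcomp Require Import all_classical all_reals all_analysis.
From mathcomp Require Import measurable_realfun ring.
Import Order.TTheory GRing.Theory Num.Theory.
Import numFieldNormedType.Exports.
Local Open Scope classical_set_scope.
Local Open Scope ring_scope.

(* On [0, 1[ the measure mu is the sum, over all words w of length k >= 0 over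
   the alphabet A, of the point masses of weight b^-k at w / b^k. An admissible
   integer with at least l digits is uniquely p * b^k + w, with p admissible of
   length l and w a word of length k, and its inverse is b^-k / (p + w / b^k).
   Hence K is the head sum plus the integral against mu of the sum over p of
   1 / (p + x).
   Writing I_m for the integral of x^m times the sum over p of
   1 / (p^m (p + x)), the identity
     1 / (p^m (p + x)) + x / (p^(m+1) (p + x)) = 1 / p^(m+1)
   gives I_m + I_(m+1) = u_m * sum_p 1 / p^(m+1). So the partial sums of the
   alternating series are I_0 - (-1)^m I_m, with 0 <= I_m <= u_m * sum_p 1 / p
   tending to 0 by dominated convergence. Strict decrease of u_m comes from
   the atom of mu at d / b for a nonzero digit d in A. *)

Lemma big_nat_mul_block (T : Type) (idx : T) (op : Monoid.law idx)
    (k m n : nat) (F : nat -> T) : (m <= n)%N ->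
  \big[op/idx]_(m * k <= j < n * k) F j =
  \big[op/idx]_(m <= i < n) \big[op/idx]_(0 <= j < k) F (i * k + j)%N.
Proof.
elim: n => [|n IHn].
  by rewrite leqn0 => /eqP ->; rewrite !big_geq.
rewrite leq_eqVlt => /orP[/eqP ->|]; first by rewrite !big_geq.
rewrite ltnS => mn; rewrite big_nat_recr//= -IHn//.
rewrite (big_cat_nat _ (n := n * k)) ?leq_mul//=.
by congr (op _ _); rewrite -{1}[(n * k)%N]add0n big_addn mulSn addnK;
   apply: eq_bigr => i _; rewrite addnC.
Qed.

(** * Words over [A] and admissible integers *)

Section Words.
Variables (b : nat) (A : {set 'I_b}).
Hypothesis hb : (1 < b)%N.

Let b_gt0 : (0 < b)%N := ltnW hb.

(* [word l n] : the base-[b] expansion of [n], padded with leading zeros or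
   truncated to its [l] lowest digits, is a word over [A]. *)
Definition word (l n : nat) : bool :=
  [forall i : 'I_l, digit_in A (n %/ b ^ i %% b)%N].

Lemma wordP (l n : nat) :
  reflect (forall i, (i < l)%N -> digit_in A (n %/ b ^ i %% b)%N) (word l n).
Proof.
apply: (iffP forallP) => [H i il|H i]; first exact: (H (Ordinal il)).
exact: H.
Qed.

Lemma word0 (n : nat) : word 0 n.
Proof. by apply/wordP. Qed.

(** Since [w < b ^ k], no carry occurs: the [k] lowest digits of [p * b ^ k + w] are those of [w],
    and the digits above them are those of [p]. *)
Lemma word_cat (k l p w : nat) : (w < b ^ k)%N ->
  word (k + l) (p * b ^ k + w) = word k w && word l p.
Proof.
move=> wk.
have lo i : (i < k)%N -> ((p * b ^ k + w) %/ b ^ i %% b = w %/ b ^ i %% b)%N.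
  move=> ik; rewrite -[in X in (p * X)%N](subnK (ltnW ik)) expnD mulnA.
  rewrite divnMDl ?expn_gt0 ?b_gt0//.
  by rewrite -(subnSK ik) expnSr mulnA modnMDl.
have hi i : ((p * b ^ k + w) %/ b ^ (k + i) %% b = p %/ b ^ i %% b)%N.
  by rewrite expnD divnMA divnMDl ?expn_gt0 ?b_gt0// (divn_small wk) addn0.
apply/wordP/andP => [H|[/wordP Hw /wordP Hp] i ikl].
  split; apply/wordP => i il.
    by rewrite -lo//; apply: H; rewrite ltn_addr.
  by rewrite -hi; apply: H; rewrite ltn_add2l.
have [ik|ki] := ltnP i k; first by rewrite lo// Hw.
by rewrite -(subnKC ki) hi; apply: Hp; rewrite ltn_subLR.
Qed.

Lemma big_word_cat (T : Type) (idx : T) (op : Monoid.com_law idx)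
    (k l m n : nat) (F : nat -> T) : (m <= n)%N ->
  \big[op/idx]_(m * b ^ k <= j < n * b ^ k | word (k + l) j) F j =
  \big[op/idx]_(m <= p < n | word l p)
    \big[op/idx]_(0 <= w < b ^ k | word k w) F (p * b ^ k + w)%N.
Proof.
move=> mn; rewrite big_mkcond big_nat_mul_block// [RHS]big_mkcond/=.
apply: eq_bigr => p _; rewrite [in RHS]big_mkcond/=.
transitivity (\big[op/idx]_(0 <= w < b ^ k)
    if word k w && word l p then F (p * b ^ k + w)%N else idx).
  by apply: eq_big_nat => w /andP[_ wk]; rewrite word_cat.
case: (word l p); last by rewrite big1// => w _; rewrite andbF.
by apply: eq_bigr => w _; rewrite andbT.
Qed.

Lemma numlen_eqS (n l : nat) :
  (numlen b n == l.+1) = (b ^ l <= n < b ^ l.+1)%N.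
Proof.
apply/eqP/idP => [E|H]; last exact: up_log_eq.
rewrite -E numlenP// andbT leqNgt; apply/negP => /(numlen_min hb).
by rewrite E ltnn.
Qed.

Lemma admissible_word (n l : nat) :
  (b ^ l <= n < b ^ l.+1)%N -> admissible A n = word l.+1 n.
Proof.
move=> nl; have := nl; rewrite -numlen_eqS => /eqP E.
have n0 : n != 0%N.
  by rewrite -lt0n; apply: leq_trans (andP nl).1; rewrite expn_gt0 b_gt0.
by rewrite /admissible (negbTE n0) E.
Qed.

Lemma digit_ge_numlen (n i : nat) :
  (numlen b n <= i)%N -> (n %/ b ^ i %% b = 0)%N.
Proof.
move=> ni; rewrite divn_small ?mod0n//.
by apply: leq_trans (numlenP n hb) _; rewrite leq_exp2l.
Qed.

(** When 0 is an allowed digit, padding with leading zeros does not affect membership of the digits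
    in [A]. *)
Lemma admissible_word_zero (n l : nat) : digit_in A 0 -> (n < b ^ l)%N ->
  admissible A n = word l n.
Proof.
move=> A0 nl; have nl' := numlen_min hb nl; rewrite /admissible.
case: eqP => [->|n0].
  by rewrite A0; symmetry; apply/wordP => i _; rewrite div0n mod0n.
apply/idP/wordP => [/(wordP _) H i il|H].
  have [/H//|/digit_ge_numlen ->//] := ltnP i (numlen b n).
by apply/(wordP _) => i il; apply: H; apply: leq_trans nl'.
Qed.

(** When 0 is a forbidden digit, a word cannot start with 0, so it has full length as an integer;
    this is the role of the condition on [numlen] in [mu]. Length 0 is left out: the empty word has
    value 0, which is not admissible here. *)
Lemma admissible_word_nozero (n l : nat) : ~~ digit_in A 0 ->
  (n < b ^ l.+1)%N ->
  admissible A n && (l.+1 <= numlen b n)%N = word l.+1 n.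
Proof.
move=> A0 nl; have [ln|ln] := leqP l.+1 (numlen b n).
  rewrite andbT; apply: admissible_word; rewrite -numlen_eqS eqn_leq ln andbT.
  exact: numlen_min.
rewrite andbF; apply/esym/negbTE/negP => /wordP/(_ l (ltnSn l)).
by rewrite digit_ge_numlen// (negbTE A0).
Qed.

Lemma digit_in_ltn (d : nat) : digit_in A d -> (d < b)%N.
Proof. by move=> /existsP[a /andP[_ /eqP <-]]. Qed.

Lemma digit_in_ord (a : 'I_b) : digit_in A a = (a \in A).
Proof.
apply/existsP/idP => [[c /andP[cA /eqP/val_inj <-//]]|aA].
by exists a; rewrite aA /=.
Qed.

Lemma word1 (d : nat) : (d < b)%N -> word 1 d = digit_in A d.
Proof.
move=> db; apply/wordP/idP => [/(_ 0%N isT)|Hd [|//] _];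
by rewrite expn0 divn1 modn_small.
Qed.

Lemma card_word (l : nat) :
  (\sum_(0 <= w < b ^ l | word l w) 1 = #|A| ^ l)%N.
Proof.
elim: l => [|l IHl].
  by rewrite expn0 big_mkcond big_nat1 word0.
(* The bounds are put in the form [0 * b ^ 1] and [b ^ l * b ^ 1] so that [big_word_cat] splits off
   the lowest digit. *)
rewrite -add1n [in LHS]addnC expnD -{1}(mul0n (b ^ 1)%N) addnC.
rewrite (@big_word_cat _ _ addn 1 l 0 (b ^ l)%N (fun=> 1%N))//.
have E1 : (\sum_(0 <= w < b ^ 1 | word 1 w) 1 = #|A|)%N.
  rewrite expn1 big_mkcond.
  rewrite (eq_big_nat _ _ (F2 := fun d => if digit_in A d then 1%N else 0%N));
    last by move=> d /andP[_ db]; rewrite word1.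
  rewrite big_mkord -big_mkcond/= -sum1_card.
  by apply: eq_bigl => a; rewrite digit_in_ord.
under eq_bigr do rewrite E1 -[#|A|]muln1.
by rewrite -big_distrr/= IHl -expnS.
Qed.

(** The witness is the integer whose [l.+1] digits all equal the nonzero digit [d], built by
    appending [d] on the right. *)
Lemma exists_word_level (l : nat) :
  (exists2 d, (0 < d)%N & digit_in A d) ->
  exists2 n, (b ^ l <= n < b ^ l.+1)%N & word l.+1 n.
Proof.
move=> [d d0 Ad]; have db := digit_in_ltn _ Ad.
elim: l => [|l [n /andP[ln nl] Wn]].
  by exists d; rewrite ?word1// expn0 expn1 d0.
exists (n * b ^ 1 + d)%N; last first.
  by rewrite -[l.+2]add1n word_cat ?expn1 ?word1 ?Ad.
rewrite expn1 [(b ^ l.+1)%N]expnSr [(b ^ l.+2)%N]expnSr; apply/andP; split.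
  by apply: leq_trans (leq_addr _ _); rewrite leq_mul2r ln orbT.
apply: (@leq_trans (n.+1 * b)); first by rewrite mulSn addnC ltn_add2r.
by rewrite leq_mul2r nl orbT.
Qed.

End Words.

Arguments word {b} A l n.

(** * Integration against [mu] over the unit interval *)

Section IntegralMu.
Variables (R : realType) (b : nat) (A : {set 'I_b}).
Hypothesis hb : (1 < b)%N.

Let b_gt0 (l : nat) : 0 < (b%:R : R) ^+ l.
Proof. by rewrite exprn_gt0// ltr0n ltnW. Qed.

Let D : set R := `[0, 1[%classic.

Let mD : measurable D.
Proof. exact: measurable_itv. Qed.

Lemma mem_unit_frac (n l : nat) :
  ((n%:R : R) / b%:R ^+ l \in D) = (n < b ^ l)%N.
Proof.
rewrite /D mem_setE in_itv/= divr_ge0 ?(ltW (b_gt0 l))//=.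
by rewrite ltr_pdivrMr ?b_gt0// mul1r -natrX ltr_nat.
Qed.

Variable f : R -> R.
Hypothesis f0 : forall x, x \in `[0, 1[ -> 0 <= f x.
Hypothesis mf : measurable_fun D f.

Let mfE : measurable_fun D (fun x => (f x)%:E).
Proof. exact/measurable_EFinP. Qed.

Let f0E x : D x -> (0 <= (f x)%:E)%E.
Proof. by move=> Dx; rewrite lee_fin f0. Qed.

Lemma integral_dirac_unit (a : R) :
  (\int[dirac a]_(x in D) (f x)%:E = if a \in D then (f a)%:E else 0)%E.
Proof.
rewrite (integral_dirac a)// diracE.
by case: (a \in D); rewrite ?mul1e ?mul0e.
Qed.

(** The atom [n / b ^ l] lies in [[0, 1[] exactly when [n < b ^ l], which truncates the series of
    point masses to a finite sum. *)
Lemma integral_point_masses (P : pred nat) (l : nat) :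
  (\int[point_masses R b P l]_(x in D) (f x)%:E =
   (\sum_(0 <= n < b ^ l | P n) f (n%:R / b%:R ^+ l))%:E)%E.
Proof.
rewrite /point_masses ge0_integral_measure_series//.
rewrite (eq_eseriesr (g := fun n => if P n && (n < b ^ l)%N
    then (f (n%:R / b%:R ^+ l))%:E else 0%E)); last first.
  move=> n _; case: (P n) => /=; last exact: integral_measure_zero.
  by rewrite integral_dirac_unit mem_unit_frac.
have g0 n : (0 <= if P n && (n < b ^ l)%N
    then (f (n%:R / b%:R ^+ l))%:E else 0)%E.
  case: ifP => // /andP[_ nl]; rewrite lee_fin f0//.
  by have := mem_unit_frac n l; rewrite nl mem_setE => ->.
rewrite (nneseries_split 0 (b ^ l)%N)// add0n.
rewrite [X in (_ + X)%E]eseries0 ?adde0; last first.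
  by move=> n ln _; rewrite ltnNge ln andbF.
rewrite -sumEFin [RHS]big_mkcond; apply: eq_big_nat => n /andP[_ ->].
by rewrite andbT.
Qed.

(** The two cases in the definition of [mu] merge here: on [[0, 1[] both give the sum over words,
    leading zeros included when 0 is in [A]. *)
Lemma integral_mu :
  (\int[mu R A]_(x in D) (f x)%:E = \sum_(0 <= k <oo)
    (b%:R ^- k * \sum_(0 <= w < b ^ k | word A k w) f (w%:R / b%:R ^+ k))%:E)%E.
Proof.
have E (P : nat -> pred nat) :
    (\int[mseries (fun l => mscale (scale_weight R b l)
        (point_masses R b (P l) l)) 0]_(x in D) (f x)%:E = \sum_(0 <= k <oo)
    (b%:R ^- k * \sum_(0 <= w < b ^ k | P k w) f (w%:R / b%:R ^+ k))%:E)%E.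
  rewrite ge0_integral_measure_series//; apply: eq_eseriesr => k _.
  by rewrite ge0_integral_mscale// integral_point_masses -EFinM.
have T0 (P : nat -> pred nat) k : (0 <=
    (b%:R ^- k * \sum_(0 <= w < b ^ k | P k w) f (w%:R / b%:R ^+ k))%:E)%E.
  rewrite lee_fin mulr_ge0 ?invr_ge0 ?(ltW (b_gt0 k))//.
  rewrite big_seq_cond sumr_ge0// => w.
  rewrite mem_index_iota => /andP[/andP[_ wk] _]; rewrite f0//.
  by have := mem_unit_frac w k; rewrite wk mem_setE => ->.
rewrite /mu; case: ifPn => A0.
  rewrite E; apply: eq_eseriesr => k _; congr (_ * _)%:E.
  rewrite [LHS]big_mkcond [RHS]big_mkcond.
  by apply: eq_big_nat => n /andP[_ nk];
    rewrite (@admissible_word_zero _ _ hb _ k).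
rewrite ge0_integral_measure_add// integral_dirac_unit.
have -> : (0 : R) \in D by rewrite /D mem_setE in_itv/= lexx ltr01.
rewrite (E (fun l n => admissible A n && (l <= numlen b n)%N)).
(* Level 0 is split off on both sides. On the left it vanishes because 0 is not admissible, and the
   Dirac mass supplies [f 0]; on the right [f 0] comes from the empty word. *)
rewrite [in LHS]nneseries_recl//; last first.
  by move=> k _; exact: (T0 (fun l n => admissible A n && (l <= numlen b n)%N)).
rewrite [in RHS]nneseries_recl//.
rewrite !expn0 !expr0 invr1 !mul1r .
rewrite [X in (_ + (X%:E + _))%E]big_mkcond.
rewrite [X in _ = (X%:E + _)%E]big_mkcond/= !big_nat1.
rewrite word0 /= {1}/admissible eqxx (negbTE A0)/= add0e mul0r; congr (_ + _)%E.
rewrite [LHS]eseries_cond [RHS]eseries_cond; apply: eq_eseriesr => -[//|k] _.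
congr (_ * _)%:E; rewrite [LHS]big_mkcond [RHS]big_mkcond.
by apply: eq_big_nat => n /andP[_ nk]; rewrite admissible_word_nozero.
Qed.

End IntegralMu.

(** * Finiteness, limit and strict decrease of the moments *)

Section Moments.
Variables (R : realType) (b : nat) (A : {set 'I_b}).
Hypothesis hb : (1 < b)%N.
Hypothesis hAproper : A != [set: 'I_b]%SET.

Let D : set R := `[0, 1[%classic.

Let mD : measurable D.
Proof. exact: measurable_itv. Qed.

(** Level [k] has [#|A| ^ k] words of weight [b ^- k] each, so the total mass is a geometric series
    of ratio [#|A| / b], which is less than 1 because [A] is proper. *)
Lemma mu_unit_itv_lty :
  (\int[mu R A]_(x in D) (1 : R)%:E < +oo)%E.
Proof.
rewrite (integral_mu _ _ _ hb (fun=> 1))//.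
pose q : R := #|A|%:R / b%:R.
have b0 : (0 : R) < b%:R by rewrite ltr0n ltnW.
have q0 : 0 <= q by rewrite divr_ge0.
have q1 : `|q| < 1.
  rewrite ger0_norm// ltr_pdivrMr// mul1r ltr_nat.
  have /proper_card : A \proper [set: 'I_b]%SET by rewrite finset.properT.
  by rewrite cardsT card_ord.
rewrite (_ : (\sum_(0 <= k <oo) _)%E = (limn (series (geometric 1 q)))%:E).
  exact: ltry.
rewrite -EFin_lim; last exact: is_cvg_geometric_series.
apply: congr_lim; apply/funext => n /=.
rewrite sumEFin /series/=; congr _%:E; apply: eq_bigr => k _.
rewrite mul1r expr_div_n mulrC; congr (_ / _).
by rewrite -[RHS]natrX -card_word// natr_sum.
Qed.

Lemma integrable_bounded (f : R -> R) (c : R) : measurable_fun D f ->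
  (forall x, D x -> `|f x| <= c) ->
  (mu R A).-integrable D (fun x => (f x)%:E).
Proof.
move=> mf fc.
have i1 : (mu R A).-integrable D (fun=> (1 : R)%:E).
  apply/integrableP; split; first exact: measurable_cst.
  by under eq_integral do rewrite abse1; exact: mu_unit_itv_lty.
have ic : (mu R A).-integrable D (fun=> c%:E * (1 : R)%:E)%E.
  exact: integrableZl.
apply: le_integrable ic => //; first exact/measurable_EFinP.
move=> x Dx; rewrite mule1 lee_fin (le_trans (fc x Dx))//; exact: ler_norm.
Qed.

Lemma measurable_monomial (m : nat) :
  measurable_fun D (fun x : R => x ^+ m).
Proof. by apply: measurable_funX; exact: measurable_id. Qed.

Lemma integrable_monomial (m : nat) :
  (mu R A).-integrable D (fun x : R => (x ^+ m)%:E).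
Proof.
apply: (integrable_bounded _ 1); first exact: measurable_monomial.
move=> x; rewrite /D/= in_itv/= => /andP[x0 x1].
by rewrite ger0_norm ?exprn_ge0// exprn_ile1// ltW.
Qed.

Lemma moment_ge0 (m : nat) : 0 <= moment R A m.
Proof.
apply: fine_ge0; apply: integral_ge0 => x.
by rewrite /= in_itv/= => /andP[x0 x1]; rewrite lee_fin exprn_ge0.
Qed.

Lemma cvg_moment : moment R A @ \oo --> (0 : R).
Proof.
pose f_ (n : nat) (x : R) := (x ^+ n)%:E.
have [] := @dominated_convergence _ _ _ (mu R A) D mD f_ (fun=> 0%E)
  (fun=> 1%E).
- by move=> n; apply/measurable_EFinP; exact: measurable_monomial.
- exact: measurable_cst.
- apply: aeW => x; rewrite /D/= in_itv/= => /andP[x0 x1].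
  apply: cvg_EFin; first exact: nearW.
  by apply: cvg_expr; rewrite ger0_norm.
- exact: (integrable_monomial 0).
- apply: aeW => x n; rewrite /D/= in_itv/= => /andP[x0 x1].
  by rewrite lee_fin ger0_norm ?exprn_ge0// exprn_ile1// ltW.
move=> _ _; rewrite integral0 => /fine_cvg; exact.
Qed.

Hypothesis hA0 : A != [set i : 'I_b | nat_of_ord i == 0%N]%SET.

(** Otherwise 0 would be the only element of the nonempty set [A], which [hA0] excludes. *)
Lemma exists_nonzero_digit : A != finset.set0 ->
  exists2 d, (0 < d)%N & digit_in A d.
Proof.
move=> An0; apply: contrapT => noD; case/set0Pn: An0 => a aA.
have zA c : c \in A -> nat_of_ord c = 0%N.
  move=> cA; apply/eqP; rewrite -leqn0 leqNgt; apply/negP => c0.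
  by apply: noD; exists (nat_of_ord c); rewrite ?digit_in_ord.
move/eqP: hA0; apply; apply/setP => c; rewrite inE.
apply/idP/eqP => [/zA//|c0].
by rewrite (_ : c = a)//; apply: val_inj; rewrite /= c0 zA.
Qed.

(** The difference of consecutive moments is the integral of [x ^+ m * (1 - x)], nonnegative on [[0,
    1[] and positive at the atom [d / b]. For empty [A], [mu] is the point mass at 0 and all moments
    with [m > 0] vanish, so strictness fails. *)
Lemma decreasing_moment : A != finset.set0 -> decreasing_seq (moment R A).
Proof.
move=> /exists_nonzero_digit [d d0 Ad]; apply/decreasing_seqP => m.
pose f (x : R) := x ^+ m - x ^+ m.+1.
have fE x : f x = x ^+ m * (1 - x) by rewrite /f exprSr mulrBr mulr1.
have f0 x : x \in `[0, 1[ -> 0 <= f x.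
  rewrite in_itv/= => /andP[x0 x1].
  by rewrite fE mulr_ge0 ?exprn_ge0// subr_ge0 ltW.
have mf : measurable_fun D f.
  by apply: measurable_funB; exact: measurable_monomial.
have intf : (mu R A).-integrable D (fun x => (f x)%:E).
  apply: (integrable_bounded _ 1) => // x Dx; rewrite ger0_norm ?f0//.
  move: Dx; rewrite /D/= in_itv/= => /andP[x0 x1].
  have x1' := ltW x1; rewrite fE mulr_ile1 ?exprn_ge0 ?exprn_ile1 ?subr_ge0//.
  by rewrite gerDl oppr_le0.
rewrite -subr_gt0.
have -> : moment R A m - moment R A m.+1 = \int[mu R A]_(x in D) f x.
  by rewrite /moment -RintegralB//; exact: integrable_monomial.
rewrite -lte_fin fineK; last exact: integrable_fin_num.
rewrite (integral_mu _ _ _ hb)//.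
have db := digit_in_ltn _ _ _ Ad.
have bR : (0 : R) < b%:R by rewrite ltr0n ltnW.
have unit_frac k w : (w < b ^ k)%N -> 0 <= f (w%:R / b%:R ^+ k).
  move=> wk; apply: f0; have := mem_unit_frac R b hb w k.
  by rewrite wk mem_setE => ->.
have T0 k P : 0 <= \sum_(0 <= w < b ^ k | P w) f (w%:R / b%:R ^+ k).
  rewrite big_seq_cond sumr_ge0// => w.
  by rewrite mem_index_iota => /andP[/andP[_ wk] _]; exact: unit_frac.
(* Words of length 0 and 1 suffice as a lower bound, since [d] is a word of length 1. *)
apply: (@lt_le_trans _ _ (\sum_(0 <= k < 2)
    (b%:R ^- k * \sum_(0 <= w < b ^ k | word A k w) f (w%:R / b%:R ^+ k))%:E)%E);
  last first.
  apply: nneseries_lim_ge => k _ _.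
  by rewrite lee_fin mulr_ge0 ?invr_ge0 ?exprn_ge0 ?(ltW bR).
rewrite sumEFin lte_fin big_nat_recl// big_nat1.
apply: ltr_wpDl; first by rewrite mulr_ge0 ?invr_ge0 ?exprn_ge0 ?(ltW bR).
apply: mulr_gt0; first by rewrite invr_gt0 exprn_gt0.
have -> : (b ^ 1 = b)%N by rewrite expn1.
(* Cutting the sum at [d] isolates its term, positive because [0 < d < b]; the other terms are
   nonnegative. *)
rewrite (big_cat_nat _ (n := d))//= ?(ltnW db)// ltr_wpDl//.
  rewrite big_seq_cond sumr_ge0// => w.
  rewrite mem_index_iota => /andP[/andP[_ wk] _]; apply: unit_frac.
  by rewrite expn1 (ltn_trans wk).
rewrite big_mkcond big_ltn// word1// Ad ltr_pwDl//.
  rewrite fE expr1; apply: mulr_gt0.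
    by rewrite exprn_gt0// divr_gt0// ltr0n.
  by rewrite subr_gt0 ltr_pdivrMr// mul1r ltr_nat.
rewrite -big_mkcond big_seq_cond sumr_ge0// => w.
rewrite mem_index_iota => /andP[/andP[_ wk] _]; apply: unit_frac.
by rewrite expn1.
Qed.

End Moments.

(** On nonnegative reals the inverse agrees with the real power of exponent -1, which is
    measurable. *)
Lemma measurable_funV_ge0 (R : realType) (D : set R) (g : R -> R) :
  measurable D -> measurable_fun D g -> (forall x, D x -> 0 <= g x) ->
  measurable_fun D (fun x => (g x)^-1).
Proof.
move=> mD mg g0; apply: (eq_measurable_fun (fun x => powR (g x) (-1))).
  by move=> x /set_mem Dx; rewrite powR_inv1// g0.
by apply: (measurableT_comp (measurable_powR (-1))).
Qed.

(** * Geometric remainders, the alternating series and the Kempner sum *)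

Section Kempner.
Variables (R : realType) (b : nat) (A : {set 'I_b}).
Hypothesis hb : (1 < b)%N.
Hypothesis hAproper : A != [set: 'I_b]%SET.
Variable l : nat.

Let D : set R := `[0, 1[%classic.

Let mD : measurable D.
Proof. exact: measurable_itv. Qed.

Lemma level_sumE (m : nat) : level_sum R A l.+1 m =
  \sum_(b ^ l <= p < b ^ l.+1 | word A l.+1 p) (p%:R ^+ m.+1)^-1.
Proof.
rewrite /level_sum (big_cat_nat _ (n := (b ^ l)%N)) ?leq_exp2l//=.
rewrite [X in X + _]big_nat_cond big_pred0 ?add0r; last first.
  move=> n; rewrite numlen_eqS// ltnNge; case: (b ^ l <= n)%N => //=.
  by rewrite andbF.
rewrite [LHS]big_nat_cond [RHS]big_nat_cond; apply: eq_bigl => n.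
apply: andb_id2l => nl.
by rewrite numlen_eqS// nl andbT (admissible_word _ _ hb n l).
Qed.

Lemma level_gt0 (p : nat) : (b ^ l <= p)%N -> (0 : R) < p%:R.
Proof. by move=> lp; rewrite ltr0n (leq_trans _ lp)// expn_gt0 ltnW. Qed.

Lemma level_sum_ge0 (m : nat) : 0 <= level_sum R A l.+1 m.
Proof. by rewrite sumr_ge0// => n _; rewrite invr_ge0 exprn_ge0. Qed.

Lemma level_sum_nonincreasing (m : nat) :
  level_sum R A l.+1 m.+1 <= level_sum R A l.+1 m.
Proof.
rewrite !level_sumE big_nat_cond [leRHS]big_nat_cond; apply: ler_sum => p.
move=> /andP[/andP[lp _] _]; have p0 := level_gt0 _ lp.
rewrite lef_pV2 ?posrE ?exprn_gt0// [leRHS]exprSr ler_peMr ?exprn_ge0//.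
by rewrite ler1n -(@ltr0n R).
Qed.

Lemma level_sum_gt0 (m : nat) : (exists2 d, (0 < d)%N & digit_in A d) ->
  0 < level_sum R A l.+1 m.
Proof.
move=> /(exists_word_level _ _ hb l)[n nl Wn].
rewrite level_sumE (big_rem n)/=; last by rewrite mem_index_iota.
rewrite Wn ltr_pwDl//.
  by rewrite invr_gt0 exprn_gt0// level_gt0//; case/andP: nl.
by rewrite sumr_ge0// => p _; rewrite invr_ge0 exprn_ge0.
Qed.

(* [remainder m x] is, up to sign, the error made when each [1 / (p + x)] with
   [p] on level [l.+1] is replaced by its geometric expansion up to [x ^ m]. *)
Definition remainder (m : nat) (x : R) : R :=
  x ^+ m * \sum_(b ^ l <= p < b ^ l.+1 | word A l.+1 p)
    (p%:R ^+ m * (p%:R + x))^-1.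

Lemma remainder_ge0 (m : nat) (x : R) : x \in `[0, 1[ -> 0 <= remainder m x.
Proof.
rewrite in_itv/= => /andP[x0 _].
rewrite mulr_ge0 ?exprn_ge0// sumr_ge0// => p _.
by rewrite invr_ge0 mulr_ge0 ?exprn_ge0// addr_ge0.
Qed.

Lemma remainder_rec (m : nat) (x : R) : x \in `[0, 1[ ->
  remainder m x + remainder m.+1 x = x ^+ m * level_sum R A l.+1 m.
Proof.
rewrite in_itv/= => /andP[x0 _].
rewrite level_sumE /remainder exprSr -mulrA -mulrDr mulr_sumr -big_split/=.
congr (_ * _); rewrite big_nat_cond [RHS]big_nat_cond; apply: eq_bigr => p.
move=> /andP[/andP[lp _] _]; have p0 := level_gt0 _ lp.
have pm0 : (p%:R : R) ^+ m != 0 by rewrite expf_neq0// gt_eqF.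
have px0 : (p%:R + x : R) != 0 by rewrite gt_eqF// ltr_wpDr.
rewrite exprSr; field.
by rewrite pm0 px0 gt_eqF.
Qed.

Lemma remainder_le (m : nat) (x : R) : x \in `[0, 1[ ->
  remainder m x <= x ^+ m * level_sum R A l.+1 m.
Proof.
by move=> x01; rewrite -remainder_rec// lerDl; exact: remainder_ge0.
Qed.

Lemma measurable_remainder (m : nat) : measurable_fun D (remainder m).
Proof.
apply: measurable_funM; first exact: measurable_monomial.
(* Filtering the index list turns the conditional sum into an unconditional one, as [measurable_sum]
   expects. *)
under eq_fun do rewrite -big_filter.
apply: measurable_sum => p; apply: measurable_funV_ge0 => //.
  apply: measurable_funM; first exact: measurable_cst.
  by apply: measurable_funD; [exact: measurable_cst|exact: measurable_id].
move=> x; rewrite /D/= in_itv/= => /andP[x0 _].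
by rewrite mulr_ge0 ?exprn_ge0// addr_ge0.
Qed.

Lemma integrable_remainder (m : nat) :
  (mu R A).-integrable D (fun x => (remainder m x)%:E).
Proof.
apply: (integrable_bounded _ _ _ hb hAproper _ (level_sum R A l.+1 m)).
  exact: measurable_remainder.
move=> x Dx; rewrite ger0_norm ?remainder_ge0//.
apply: (le_trans (remainder_le _ _ Dx)).
move: Dx; rewrite /D/= in_itv/= => /andP[x0 x1].
by rewrite ler_piMl ?level_sum_ge0// exprn_ile1// ltW.
Qed.

Let I m := \int[mu R A]_(x in D) remainder m x.

Lemma integral_remainder_ge0 (m : nat) : 0 <= I m.
Proof.
by apply: fine_ge0; apply: integral_ge0 => x Dx; rewrite lee_fin remainder_ge0.
Qed.

Lemma integral_remainder_rec (m : nat) :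
  I m + I m.+1 = moment R A m * level_sum R A l.+1 m.
Proof.
rewrite -RintegralD//; [|exact: integrable_remainder..].
rewrite -RintegralZr//; last exact: integrable_monomial.
by apply: eq_Rintegral => x /set_mem Dx; exact: remainder_rec.
Qed.

Lemma integral_remainder_le (m : nat) :
  I m <= moment R A m * level_sum R A l.+1 m.
Proof. by rewrite -integral_remainder_rec lerDl integral_remainder_ge0. Qed.

(** The level sums do not increase with [m], so they are bounded by the one at [m = 0], and the
    moments tend to 0. *)
Lemma cvg_moment_level_sum :
  (fun m => moment R A m * level_sum R A l.+1 m) @ \oo --> (0 : R).
Proof.
apply: (@squeeze_cvgr _ _ _ _ (fun=> 0)
  (fun m => moment R A m * level_sum R A l.+1 0)).
- apply: nearW => m; rewrite mulr_ge0 ?moment_ge0 ?level_sum_ge0//=.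
  rewrite ler_wpM2l ?moment_ge0//.
  elim: m => // m IHm; exact: le_trans (level_sum_nonincreasing m) IHm.
- exact: cvg_cst.
- rewrite -[X in _ --> X](mul0r (level_sum R A l.+1 0)).
  by apply: cvgM; [exact: cvg_moment|exact: cvg_cst].
Qed.

Lemma cvg_integral_remainder : I @ \oo --> (0 : R).
Proof.
apply: (@squeeze_cvgr _ _ _ _ (fun=> 0)
  (fun m => moment R A m * level_sum R A l.+1 m)).
- by apply: nearW => m; rewrite integral_remainder_ge0 integral_remainder_le.
- exact: cvg_cst.
- exact: cvg_moment_level_sum.
Qed.

Lemma series_alt_term (m : nat) :
  series (alt_term R A l.+1) m = I 0 - (-1) ^+ m * I m.
Proof.
rewrite /series/=; elim: m => [|m IHm].
  by rewrite big_geq// expr0 mul1r subrr.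
rewrite big_nat_recr//= IHm /alt_term -mulrA -integral_remainder_rec exprS.
by ring.
Qed.

Lemma cvg_series_alt_term : series (alt_term R A l.+1) @ \oo --> I 0.
Proof.
rewrite (_ : series _ = (fun m => I 0 - (-1) ^+ m * I m)); last first.
  by apply/funext => m; exact: series_alt_term.
rewrite -[X in _ --> X]subr0; apply: cvgB; first exact: cvg_cst.
(* Convergence to 0 may be tested on norms, where the alternating sign disappears. *)
apply/norm_cvg0P; under eq_cvg do rewrite normrM normrX normrN1 expr1n mul1r.
by apply/norm_cvg0P; exact: cvg_integral_remainder.
Qed.

(** Admissible integers with [l + k + 1] digits account for level [k] of [mu]: the right-hand side
    is the term of index [k] in [integral_mu] applied to [remainder 0]. *)
Lemma level_block (k : nat) :
  \sum_(b ^ (l + k) <= n < b ^ (l + k).+1 | admissible A n) (n%:R : R)^-1 =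
  b%:R ^- k * \sum_(0 <= w < b ^ k | word A k w) remainder 0 (w%:R / b%:R ^+ k).
Proof.
have bk0 : (b%:R : R) ^+ k != 0 by rewrite expf_neq0// pnatr_eq0 -lt0n ltnW.
transitivity (\sum_(b ^ l * b ^ k <= n < b ^ l.+1 * b ^ k |
    word A (k + l.+1) n) (n%:R : R)^-1).
  rewrite -!expnD big_nat_cond [RHS]big_nat_cond addSn; apply: eq_bigl => n.
  apply: andb_id2l => nl.
  by rewrite (admissible_word _ _ hb n (l + k))// addnS addnC.
rewrite big_word_cat ?leq_exp2l// mulr_sumr exchange_big/=.
apply: eq_bigr => w _; rewrite /remainder expr0 mul1r mulr_sumr.
apply: eq_bigr => p _; rewrite expr0 mul1r -invfM natrD natrM natrX.
by congr (_^-1); rewrite mulrDr mulrCA mulfV// mulr1 mulrC.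
Qed.

(** The partial sums are followed along the cut points [b ^ (l + k)], where they equal the head sum
    plus [k] blocks; uniqueness of limits in the extended reals then identifies the two values and
    gives finiteness as well. *)
Lemma kempner_sumE : kempner_sum R A = (head_sum R A l.+1 + I 0)%:E.
Proof.
pose s (n : nat) := (\sum_(1 <= i < n | admissible A i) ((i%:R : R)^-1)%:E)%E.
pose t (k : nat) : R :=
  b%:R ^- k * \sum_(0 <= w < b ^ k | word A k w) remainder 0 (w%:R / b%:R ^+ k).
have s_cvg : s @ \oo --> kempner_sum R A.
  by apply: is_cvg_nneseries => n _ _; rewrite lee_fin invr_ge0.
have pow_cvg : (fun k => (b ^ (l + k))%N) @ \oo --> \oo.
  apply/cvgnyPge => N; near=> k.
  apply: (@leq_trans k); first by near: k; exact: nbhs_infty_ge.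
  by apply: leq_trans (leq_addl l k) (ltnW (ltn_expl _ hb)).
have sE k : s (b ^ (l + k))%N =
    ((head_sum R A l.+1)%:E + \sum_(0 <= j < k) (t j)%:E)%E.
  rewrite /s sumEFin sumEFin -EFinD; congr _%:E.
  (* For [k = 0] both sides agree because the head sum of level [l.+1] stops just before [b ^ l]. *)
  elim: k => [|k IHk]; first by rewrite addn0 [in RHS]big_geq// addr0.
  rewrite big_nat_recr//= addrA -IHk addnS /t -level_block -big_cat_nat//=.
    by rewrite expn_gt0 ltnW.
  by rewrite leq_exp2l.
have t_cvg : (fun k => \sum_(0 <= j < k) (t j)%:E)%E @ \oo --> (I 0)%:E.
  (* Integrability of the remainder allows the real number [I 0] to be read as the extended
     integral. *)
  rewrite fineK; last exact/integrable_fin_num/integrable_remainder.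
  rewrite (integral_mu _ _ _ hb _ (remainder_ge0 0) (measurable_remainder 0)).
  apply: is_cvg_nneseries => k _ _; rewrite lee_fin /t -level_block.
  by rewrite sumr_ge0// => n _; rewrite invr_ge0.
have s_cvg' := cvg_comp _ _ pow_cvg s_cvg.
apply: (cvg_unique _ s_cvg'); first exact: ereal_hausdorff.
rewrite (_ : s \o _ = fun k =>
  ((head_sum R A l.+1)%:E + \sum_(0 <= j < k) (t j)%:E)%E); last first.
  by apply/funext => k; exact: sE.
rewrite EFinD; apply: cvgeD => //; exact: cvg_cst.
Unshelve. all: by end_near. Qed.

End Kempner.

Theorem theorem2 (R : realType) (b : nat) (A : {set 'I_b})
    (hb : (1 < b)%N)
    (hAproper : A != [set: 'I_b]%SET)
    (hA0 : A != [set i : 'I_b | nat_of_ord i == 0%N]%SET) :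
  (forall m : nat, (mu R A).-integrable `[0, 1[ (fun x : R => (x ^+ m)%:E))
  /\ (forall l : nat, (1 <= l)%N ->
        cvgn (series (alt_term R A l)) /\
        kempner_sum R A = (head_sum R A l + limn (series (alt_term R A l)))%:E)
  /\ (A != finset.set0 -> decreasing_seq (moment R A))
  /\ (moment R A @ \oo --> (0 : R))
  /\ (forall l : nat, (1 <= l)%N ->
        (A != finset.set0 -> decreasing_seq (fun m : nat => `|alt_term R A l m|)) /\
        ((fun m : nat => `|alt_term R A l m|) @ \oo --> (0 : R))).
Proof.
split; first by move=> m; exact: integrable_monomial.
split.
  move=> [//|l] _.
  have cvg_alt := cvg_series_alt_term R b A hb hAproper l.
  split; first by apply/cvg_ex; eexists; exact: cvg_alt.
  rewrite (cvg_lim _ cvg_alt); last exact: norm_hausdorff.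
  exact: kempner_sumE.
have decr := decreasing_moment R b A hb hAproper hA0.
split=> //; split; first exact: cvg_moment.
move=> [//|l] _.
have -> : (fun m => `|alt_term R A l.+1 m|) =
    (fun m => moment R A m * level_sum R A l.+1 m).
  apply/funext => m; rewrite !normrM normrX normrN1 expr1n mul1r.
  by rewrite !ger0_norm ?moment_ge0 ?level_sum_ge0.
split; last exact: cvg_moment_level_sum.
move=> An0; apply/decreasing_seqP => m.
have d := exists_nonzero_digit _ _ hA0 An0.
(* Strictness comes from the moments alone, multiplied by a positive level sum; the level sums only
   need to be nonincreasing. *)
apply: (@le_lt_trans _ _ (moment R A m.+1 * level_sum R A l.+1 m)).
  by rewrite ler_wpM2l ?moment_ge0 ?level_sum_nonincreasing.
rewrite ltr_pM2r ?level_sum_gt0//.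
by have /decreasing_seqP := decr An0; exact.
Qed.
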